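(* A finite simple graph $G$ is a sesquicograph if and only if $G$ has no induced subgraph isomorphic to any of the following graphs: (i) a cycle $C_n$ with $n \geq 5$; (ii) $\overline{P_5}$, $C_6^+$, $H_1$, $H_2$, $H_3$, $H_4$, $H_5$.
   Context: All graphs are finite and simple. For vertex-disjoint graphs $G$ and $H$: the $0$-sum $G \oplus H$ is their disjoint union; a $1$-sum $G \oplus_1 H$ is any graph obtained from $G \oplus H$ by identifying one vertex of $G$ with one vertex of $H$; the join $G \bigtriangledown H$ is obtained from $G \oplus H$ by adding every edge joining a vertex of $G$ to a vertex of $H$. A sesquicograph is a graph that can be generated from the one-vertex graph $K_1$ by repeatedly applying joins, $0$-sums and $1$-sums (i.e. the smallest class of graphs containing $K_1$ and closed under these three operations, up to isomorphism). $\overline{P_5}$ is the complement of the path on five vertices. The remaining graphs all have vertex set $\{1,2,3,4,5,6\}$ and contain the $6$-cycle with edges $12,23,34,45,56,61$; in addition: $C_6^+$ (the domino) has the extra edge $25$; $H_1$ has extra edges $25,35,36,26$; $H_2$ has extra edges $25,35,36$; $H_3$ has extra edges $25,36$; $H_4$ has extra edges $26,25,35$; $H_5$ has extra edges $24,26,46$. *)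

(* Defs.v *)
From HB Require Import structures.
From mathcomp Require Import all_boot.
Set Implicit Arguments.
Unset Strict Implicit.
Unset Printing Implicit Defensive.

Record sgraph := SGraph {
  vertex :> finType;
  edge : rel vertex;
  edge_sym : symmetric edge;
  edge_irrefl : irreflexive edge
}.

Definition giso (G H : sgraph) : Prop :=
  exists2 f : G -> H, bijective f & {mono f : x y / edge x y}.

(** [r] need be neither symmetric nor loopless: it is symmetrised and its loops
    are dropped. *)
Section OfRel.
Variables (T : finType) (r : rel T).

Definition simple_rel : rel T := [rel x y | (x != y) && (r x y || r y x)].

Lemma simple_rel_sym : symmetric simple_rel.
Proof. by move=> x y; rewrite /simple_rel /= eq_sym orbC. Qed.

Lemma simple_rel_irrefl : irreflexive simple_rel.
Proof. by move=> x; rewrite /simple_rel /= eqxx. Qed.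

Definition graph_of_rel : sgraph := SGraph simple_rel_sym simple_rel_irrefl.
End OfRel.

Section Induced.
Variables (G : sgraph) (S : {set G}).

Definition induced_rel : rel {x : G | x \in S} :=
  [rel x y | edge (val x) (val y)].

Lemma induced_sym : symmetric induced_rel.
Proof. by move=> x y; rewrite /induced_rel /= edge_sym. Qed.

Lemma induced_irrefl : irreflexive induced_rel.
Proof. by move=> x; rewrite /induced_rel /= edge_irrefl. Qed.

Definition induced : sgraph := SGraph induced_sym induced_irrefl.
End Induced.

Definition has_induced (G H : sgraph) : Prop :=
  exists S : {set G}, giso (induced S) H.

Definition compl (G : sgraph) : sgraph :=
  graph_of_rel [rel x y : G | ~~ edge x y].

Section Operations.
Variables G H : sgraph.

Definition sum0_rel : rel (G + H)%type := fun x y =>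
  match x, y with
  | inl u, inl v => edge u v
  | inr u, inr v => edge u v
  | _, _ => false
  end.

Lemma sum0_sym : symmetric sum0_rel.
Proof. by case=> x [] y //=; rewrite edge_sym. Qed.

Lemma sum0_irrefl : irreflexive sum0_rel.
Proof. by case=> x //=; rewrite edge_irrefl. Qed.

Definition sum0 : sgraph := SGraph sum0_sym sum0_irrefl.

Definition join_rel : rel (G + H)%type := fun x y =>
  match x, y with
  | inl u, inl v => edge u v
  | inr u, inr v => edge u v
  | _, _ => true
  end.

Lemma join_sym : symmetric join_rel.
Proof. by case=> x [] y //=; rewrite edge_sym. Qed.

Lemma join_irrefl : irreflexive join_rel.
Proof. by case=> x //=; rewrite edge_irrefl. Qed.

Definition join : sgraph := SGraph join_sym join_irrefl.
End Operations.

(** Identification of the vertices [a] and [b]: the merged vertex is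
    represented by [a], and the edges are the images of the edges of [G] under
    the quotient map (dropping the loop that would arise if [a] and [b] were
    adjacent). *)
Section Identify.
Variables (G : sgraph) (a b : G).

Definition merge (z : G) : G := if z == b then a else z.

Definition identify : sgraph :=
  graph_of_rel [rel x y : {z : G | z \in codom merge} |
    [exists x', exists y',
      [&& merge x' == val x, merge y' == val y & edge x' y']]].
End Identify.

Definition sum1 (G H : sgraph) (u : G) (v : H) : sgraph :=
  identify (inl u : sum0 G H) (inr v : sum0 G H).

Definition K1 : sgraph := graph_of_rel [rel _ _ : 'I_1 | false].

Inductive sesquicograph : sgraph -> Prop :=
| Sesqui_K1 : sesquicograph K1
| Sesqui_sum0 (G H : sgraph) :
    sesquicograph G -> sesquicograph H -> sesquicograph (sum0 G H)
| Sesqui_sum1 (G H : sgraph) (u : G) (v : H) :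
    sesquicograph G -> sesquicograph H -> sesquicograph (sum1 u v)
| Sesqui_join (G H : sgraph) :
    sesquicograph G -> sesquicograph H -> sesquicograph (join G H)
| Sesqui_giso (G H : sgraph) : giso G H -> sesquicograph G -> sesquicograph H.

(** A genuine cycle only for [n >= 3]. *)
Definition cycle_graph (n : nat) : sgraph :=
  graph_of_rel [rel i j : 'I_n | (j : nat) == i.+1 %% n].

Definition path_graph (n : nat) : sgraph :=
  graph_of_rel [rel i j : 'I_n | (j : nat) == i.+1].

(** The vertices [0, ..., n-1] of ['I_n] carry the labels [1, ..., n]. *)
Definition graph_of_edges (n : nat) (s : seq (nat * nat)) : sgraph :=
  graph_of_rel [rel i j : 'I_n | (i.+1, j.+1) \in s].

Definition hexagon_with (s : seq (nat * nat)) : sgraph :=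
  graph_of_edges 6 ([:: (1, 2); (2, 3); (3, 4); (4, 5); (5, 6); (6, 1)] ++ s).

Definition P5_compl : sgraph := compl (path_graph 5).
Definition domino : sgraph := hexagon_with [:: (2, 5)].
Definition H1 : sgraph := hexagon_with [:: (2, 5); (3, 5); (3, 6); (2, 6)].
Definition H2 : sgraph := hexagon_with [:: (2, 5); (3, 5); (3, 6)].
Definition H3 : sgraph := hexagon_with [:: (2, 5); (3, 6)].
Definition H4 : sgraph := hexagon_with [:: (2, 6); (2, 5); (3, 5)].
Definition H5 : sgraph := hexagon_with [:: (2, 4); (2, 6); (4, 6)].

(* Main.v *)
(** Every obstruction is connected, co-connected and without a cut vertex, so an
    induced copy of it in a sum or a join already lies in one of the two pieces.

    Conversely, let [G] be obstruction-free with these three connectivity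
    properties and at least one edge. Let [J] be a maximal vertex set that
    induces a join. If a vertex outside [J] had two neighbours in [J], they
    would lie in one co-component [A] of [J], whose complement in [J] is a single
    vertex [b] with neighbourhood [A]; as [b] is not a cut vertex, a path around
    it closes a forbidden graph. So each outside vertex has at most one
    neighbour in [J]. As [G] has no cut vertex, some component outside [J] is
    attached to [J] twice, which yields an induced 4-cycle [x u w y] with exactly
    [x] and [y] in [J], and this forces a dominating vertex in [J]. A maximal join
    set containing this 4-cycle then has a dominating vertex as well, and that
    vertex is outside [J] but adjacent to both [x] and [y]. *)

Require Import Defs.
From mathcomp Require Import all_boot zify.

Set Implicit Arguments.
Unset Strict Implicit.
Unset Printing Implicit Defensive.

Local Notation "x -- y" := (edge x y) (at level 30).

(** * Induced embeddings *)

Definition emb (H G : sgraph) : Prop :=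
  exists2 f : H -> G, injective f & {mono f : x y / x -- y}.

Lemma emb_trans (F H G : sgraph) : emb F H -> emb H G -> emb F G.
Proof.
move=> [f fI fM] [g gI gM]; exists (g \o f); first exact: inj_comp.
by move=> x y /=; rewrite gM fM.
Qed.

Lemma emb_induced (G : sgraph) (S : {set G}) : emb (induced S) G.
Proof. by exists val => //; apply: val_inj. Qed.

Lemma inj_surj_bij (T U : finType) (f : T -> U) :
  injective f -> (forall y, exists x, f x = y) -> bijective f.
Proof.
move=> fI fS; apply: inj_card_bij => //.
rewrite -(card_codom fI); apply/subset_leq_card/subsetP => y _.
by have [x <-] := fS y; apply: codom_f.
Qed.

Lemma giso_sym (G H : sgraph) : giso G H -> giso H G.
Proof.
move=> [f [g fK gK] fM]; exists g; first by exists f.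
by move=> x y; rewrite -[in RHS](gK x) -[in RHS](gK y) fM.
Qed.

Lemma giso_emb (G H : sgraph) : giso G H -> emb G H.
Proof. by move=> [f /bij_inj fI fM]; exists f. Qed.

Lemma has_inducedP (G H : sgraph) : has_induced G H <-> emb H G.
Proof.
split=> [[S /giso_sym/giso_emb eHS]|[f fI fM]].
  exact: emb_trans eHS (emb_induced S).
exists (f @: [set: H]); apply: giso_sym.
have fS x : f x \in f @: [set: H] by apply: imset_f.
exists (fun x => exist _ (f x) (fS x) : induced (f @: [set: H])).
  apply: inj_surj_bij => [x y /(congr1 val)/= /fI //|[y Sy]].
  by have /imsetP[x _ yE] := Sy; exists x; apply: val_inj.
by move=> x y; apply: fM.
Qed.

(** * Prime graphs *)

(* Connectedness is expressed by the edges that leave a vertex set, which is the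
   form in which an embedding into a sum or a join contradicts it. *)

Definition connectedg (G : sgraph) := forall (A : {set G}) a b,
  a \in A -> b \notin A -> exists x y, [/\ x \in A, y \notin A & x -- y].

Definition coconnectedg (G : sgraph) := forall (A : {set G}) a b,
  a \in A -> b \notin A -> exists x y, [/\ x \in A, y \notin A & ~~ x -- y].

Definition nocutg (G : sgraph) := forall (v : G) (A : {set G}) a b,
  v \notin A -> a \in A -> b \notin A -> b != v ->
  exists x y, [/\ x \in A, y \notin A, y != v & x -- y].

(** One clause per operation: connectedness blocks [sum0], co-connectedness blocks [join], and the
    absence of a cut vertex blocks a non-trivial [sum1]. The one-vertex graph satisfies all three
    vacuously. *)
Definition primeg (G : sgraph) :=
  [/\ connectedg G, coconnectedg G & nocutg G].

Lemma emb_factor (P G X : sgraph) (f : P -> X) (s : G -> X) :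
    injective f -> {mono f : x y / x -- y} -> {mono s : x y / x -- y} ->
  (forall x, exists u, f x == s u) -> emb P G.
Proof.
move=> fI fM sM fs; have fE x := eqP (xchooseP (fs x)).
exists (fun x => xchoose (fs x)) => x y.
  by move=> xy; apply: fI; rewrite (fE x) xy -(fE y).
by rewrite -sM -!fE fM.
Qed.

(** * Vertices and edges of a 1-sum *)

Section Sum1Edges.
Variables (G H : sgraph) (u : G) (v : H).
Implicit Types x y : sum1 u v.
Local Notation mrg := (@Defs.merge (sum0 G H) (inl u) (inr v)).

Lemma sum1_val x : val x != inr v.
Proof.
case: x => z /= /codomP[w ->]; rewrite /Defs.merge.
by have [_|wv] := eqVneq w (inr v).
Qed.

Lemma sum1_mem (z : sum0 G H) :
  z != inr v -> z \in codom mrg.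
Proof.
move=> zv; rewrite (_ : z = mrg z) ?codom_f //.
by rewrite /Defs.merge (negPf zv).
Qed.

Definition sum1_inl (a : G) : sum1 u v :=
  exist _ (inl a : sum0 G H) (@sum1_mem (inl a) isT).

(** The default of [insubd] matters: [inr v] is not a vertex of the quotient, so [v] falls back to
    [sum1_inl u], which is the merged vertex. *)
Definition sum1_inr (b : H) : sum1 u v :=
  insubd (sum1_inl u) (inr b : sum0 G H).

Lemma val_sum1_inr b : val (sum1_inr b) = if b == v then inl u else inr b.
Proof.
rewrite val_insubd; case: eqVneq => [->|bv]; last by rewrite sum1_mem.
case: ifP => // /codomP[w]; rewrite /Defs.merge; case: eqP => // wv wE.
by case: wv.
Qed.

Lemma sum1_inlr x : (exists a, x = sum1_inl a) \/
  (exists2 b, b != v & x = sum1_inr b).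
Proof.
have := sum1_val x; case xE: (val x) => [a|b] bv.
  by left; exists a; apply: val_inj.
by right; exists b => //; apply: val_inj; rewrite val_sum1_inr ifN.
Qed.

Lemma sum1_edgeP x y : reflect
  [/\ x != y & exists x' y' : sum0 G H, [/\ mrg x' = val x,
                       mrg y' = val y & x' -- y']]
  (x -- y).
Proof.
rewrite /edge /= /simple_rel /=; apply: (iffP andP) => -[xy]; last first.
  move=> [x' [y' [xE yE exy]]]; split=> //; apply/orP; left.
  by apply/existsP; exists x'; apply/existsP; exists y'; rewrite xE yE !eqxx.
by case/orP=> /existsP[x' /existsP[y' /and3P[/eqP xE /eqP yE exy]]];
  split=> //; [exists x', y'|exists y', x'; split=> //; rewrite sum0_sym].
Qed.

Lemma merge_eq_inl (x : sum0 G H) a : mrg x = inl a ->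
  x = inl a \/ (x = inr v /\ a = u).
Proof. by rewrite /Defs.merge; case: eqP => [-> [->]|_ ->]; [right|left]. Qed.

Lemma merge_eq_inr (x : sum0 G H) b : mrg x = inr b ->
  x = inr b.
Proof. by rewrite /Defs.merge; case: eqP. Qed.

Lemma sum1_inl_mono : {mono sum1_inl : a b / a -- b}.
Proof.
move=> a b; apply/sum1_edgeP/idP => [[_ [x [y [/= ]]]]|ab].
  case/merge_eq_inl=> [->|[-> ->]] /merge_eq_inl[->|[-> ->]] //.
  by rewrite /edge /= edge_irrefl.
split; last by exists (inl a), (inl b).
by apply: contraTneq ab => /(congr1 val)[->]; rewrite edge_irrefl.
Qed.

Lemma sum1_inr_mono : {mono sum1_inr : a b / a -- b}.
Proof.
move=> a b; apply/sum1_edgeP/idP => [[_ [x [y []]]]|ab].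
  rewrite !val_sum1_inr; case: (eqVneq a v) => [->|_]; case: (eqVneq b v) => [->|_].
  - case/merge_eq_inl=> [->|[-> _]] /merge_eq_inl[->|[-> _]] //.
    by rewrite /edge /= edge_irrefl.
  - by case/merge_eq_inl=> [->|[-> _]] /merge_eq_inr ->.
  - by move=> /merge_eq_inr -> /merge_eq_inl[->|[-> _]].
  - by move=> /merge_eq_inr -> /merge_eq_inr ->.
split; last by exists (inr a), (inr b); rewrite !val_sum1_inr.
apply: contraTneq ab => /(congr1 val); rewrite !val_sum1_inr.
case: eqP => [->|_]; case: eqP => [->|_] //.
- by rewrite edge_irrefl.
- by case=> ->; rewrite edge_irrefl.
Qed.

Lemma sum1_cross a b : a != u -> b != v -> ~~ sum1_inl a -- sum1_inr b.
Proof.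
move=> au bv; apply/sum1_edgeP => -[_ [x [y []]]].
rewrite val_sum1_inr (negPf bv) => /= /merge_eq_inl[->|[_ aE]].
  by move/merge_eq_inr ->.
by rewrite aE eqxx in au.
Qed.

End Sum1Edges.

(** * Embeddings of prime graphs into sums and joins *)

Section PrimeEmb.
Variable P : sgraph.
Hypothesis primeP : primeg P.

(** If the embedding met both summands, connectedness of [P] would give an edge across them.
    Otherwise it factors through one summand. *)
Lemma prime_emb_sum0 (G H : sgraph) : emb P (sum0 G H) -> emb P G \/ emb P H.
Proof.
case: primeP => conP _ _ [f fI fM].
pose A := [set x | if f x is inl _ then true else false].
have [A0|/set0Pn[a aA]] := eqVneq A set0.
  right; apply: (@emb_factor _ _ (sum0 G H) f inr) => // x.
  case fx: (f x) => [u|u]; last by exists u.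
  by have := in_set0 x; rewrite -A0 inE fx.
have [AT|/subsetPn[b _ bA]] := boolP ([set: P] \subset A).
  left; apply: (@emb_factor _ _ (sum0 G H) f inl) => // x.
  case fx: (f x) => [u|u]; first by exists u.
  by have := subsetP AT x (in_setT x); rewrite inE fx.
have [x [y [+ +]]] := conP A a b aA bA.
by rewrite !inE -fM; case: (f x) (f y) => [?|?] [?|?].
Qed.

(** The same split, now with a crossing non-edge supplied by co-connectedness. *)
Lemma prime_emb_join (G H : sgraph) : emb P (join G H) -> emb P G \/ emb P H.
Proof.
case: primeP => _ conP _ [f fI fM].
pose A := [set x | if f x is inl _ then true else false].
have [A0|/set0Pn[a aA]] := eqVneq A set0.
  right; apply: (@emb_factor _ _ (join G H) f inr) => // x.
  case fx: (f x) => [u|u]; last by exists u.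
  by have := in_set0 x; rewrite -A0 inE fx.
have [AT|/subsetPn[b _ bA]] := boolP ([set: P] \subset A).
  left; apply: (@emb_factor _ _ (join G H) f inl) => // x.
  case fx: (f x) => [u|u]; first by exists u.
  by have := subsetP AT x (in_setT x); rewrite inE fx.
have [x [y [+ +]]] := conP A a b aA bA.
by rewrite !inE -fM; case: (f x) (f y) => [?|?] [?|?].
Qed.

(** [A] and [B] collect the vertices sent into the two sides off the merged vertex; no edge joins
    them. If both are non-empty, a vertex [o] sent to the merged vertex is a cut vertex of [P], and
    without such an [o] the graph [P] is disconnected. *)
Lemma prime_emb_sum1 (G H : sgraph) (u : G) (v : H) :
  emb P (sum1 u v) -> emb P G \/ emb P H.
Proof.
case: primeP => conP _ cutP [f fI fM].
pose A := [set x | [exists a, (a != u) && (f x == sum1_inl u v a)]].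
pose B := [set x | [exists b, (b != v) && (f x == sum1_inr u v b)]].
have uvE : sum1_inl u v u = sum1_inr u v v.
  by apply: val_inj; rewrite val_sum1_inr eqxx.
have fE x : [|| x \in A, x \in B | f x == sum1_inl u v u].
  case: (sum1_inlr (f x)) => [[a fx]|[b bv fx]].
    have [au|au] := eqVneq a u; first by rewrite fx au eqxx !orbT.
    by rewrite (_ : x \in A) // inE; apply/existsP; exists a; rewrite au fx eqxx.
  rewrite (_ : x \in B) ?orbT // inE; apply/existsP; exists b.
  by rewrite bv fx eqxx.
have noAB x y : x \in A -> y \in B -> ~~ x -- y.
  rewrite !inE -fM => /existsP[a /andP[au /eqP->]] /existsP[b /andP[bv /eqP->]].
  exact: sum1_cross.
have [A0|/set0Pn[a aA]] := eqVneq A set0.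
  right; apply: (@emb_factor _ _ _ f (@sum1_inr G H u v)) => // [|x].
    exact: sum1_inr_mono.
  have := fE x; rewrite A0 in_set0 /= => /orP[|/eqP->]; last by exists v; rewrite uvE.
  by rewrite inE => /existsP[b /andP[_ fx]]; exists b.
have [B0|/set0Pn[b bB]] := eqVneq B set0.
  left; apply: (@emb_factor _ _ _ f (@sum1_inl G H u v)) => // [|x].
    exact: sum1_inl_mono.
  have := fE x; rewrite B0 in_set0 /= => /orP[|/eqP->]; last by exists u.
  by rewrite inE => /existsP[c /andP[_ fx]]; exists c.
have AB x : x \in A -> x \notin B.
  rewrite !inE => /existsP[c /andP[cu /eqP fx]].
  apply/existsP => -[d /andP[dv]]; rewrite fx => /eqP/(congr1 val).
  by rewrite val_sum1_inr (negPf dv).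
have [/existsP[o fo]|/existsPn noc] := boolP [exists o, f o == sum1_inl u v u].
  have oA : o \notin A.
    rewrite inE (eqP fo); apply/existsP => -[c /andP[cu /eqP/(congr1 val)[]]].
    by move=> uc; rewrite uc eqxx in cu.
  have oB : o \notin B.
    rewrite inE (eqP fo); apply/existsP => -[c /andP[cv /eqP/(congr1 val)]].
    by rewrite val_sum1_inr (negPf cv).
  have [||x [y [xA yA yo]]] := cutP o A a b oA aA.
  - by apply: contraL bB; apply: AB.
  - by apply: contraNneq oB => <-.
  have := fE y; rewrite (negPf yA) /= => /orP[yB|]; last first.
    by rewrite -(eqP fo) => /eqP/fI yo'; rewrite yo' eqxx in yo.
  by rewrite (negPf (noAB x y xA yB)).
have [|x [y [xA yA]]] := conP A a b aA; first by apply: contraL bB; apply: AB.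
have := fE y; rewrite (negPf yA) (negPf (noc y)) orbF /= => yB.
by rewrite (negPf (noAB x y xA yB)).
Qed.

End PrimeEmb.

(** [P] has too many vertices for [K1], and by the three preceding lemmas no operation creates a
    copy of it. *)
Lemma sesquicograph_prime_free (P G : sgraph) :
  primeg P -> 1 < #|P| -> sesquicograph G -> ~ emb P G.
Proof.
move=> primeP P2; elim=> {G}.
- move=> [f fI _]; have := leq_trans P2 (leq_card f fI).
  by rewrite card_ord.
- by move=> G H _ nG _ nH /(prime_emb_sum0 primeP)[].
- by move=> G H u v _ nG _ nH /(prime_emb_sum1 primeP)[].
- by move=> G H _ nG _ nH /(prime_emb_join primeP)[].
- by move=> G H /giso_sym/giso_emb HG _ nG PH; apply/nG/(emb_trans PH HG).
Qed.

(** * Components of a vertex set *)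

Lemma connect_cross (T : finType) (r : rel T) (X : {set T}) a b :
  connect r a b -> a \in X -> b \notin X ->
  exists x y, [/\ x \in X, y \notin X & r x y].
Proof.
move=> /connectP[p + ->]; elim: p a => [|x p IH] a /=; first by move=> _ ->.
case/andP=> ax xp aX; have [xX|xX] := boolP (x \in X); first exact: IH.
by exists a, x.
Qed.

Section Component.
Variables (T : finType) (r : rel T) (W : {set T}) (m : T).
Hypotheses (r_sym : symmetric r) (mW : m \in W).

Definition restr : rel T := [rel x y | [&& x \in W, y \in W & r x y]].

(** The relation is a parameter so that components (for [edge]) and co-components (for [nonedge])
    share one theory. *)
Definition component : {set T} := [set x | connect restr m x].

Lemma restr_sym : symmetric restr.
Proof. by move=> x y; rewrite /restr /= r_sym andbCA. Qed.

Lemma component_self : m \in component.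
Proof. by rewrite inE connect0. Qed.

Lemma component_sub x : x \in component -> x \in W.
Proof.
rewrite inE => mx; rewrite -(@closed_connect _ restr (mem W) _ m x) //.
by move=> a b /and3P[-> -> _].
Qed.

Lemma component_closed x y :
  x \in component -> y \in W -> r x y -> y \in component.
Proof.
move=> xC yW xy; have xW := component_sub xC; move: xC; rewrite !inE => xC.
by apply: connect_trans xC (connect1 _); apply/and3P.
Qed.

Lemma component_connect x y :
  x \in component -> y \in component -> connect restr x y.
Proof.
rewrite !inE => mx my; apply: connect_trans my.
by rewrite (sym_connect_sym restr_sym).
Qed.

Lemma component_cut (X : {set T}) a b :
  a \in component -> b \in component -> a \in X -> b \notin X ->
  exists x y, [/\ x \in component, y \in component, x \in X, y \notin X & r x y].
Proof.
move=> aC bC aX bX.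
have [||x [y [/setIP[xC xX] yCX /and3P[_ yW xy]]]] :=
    @connect_cross _ _ (component :&: X) _ _ (component_connect aC bC).
- by rewrite inE aC.
- by rewrite inE bC.
have yC := component_closed xC yW xy.
by exists x, y; split=> //; apply: contra yCX => yX; rewrite inE yC.
Qed.

Lemma component_walk x y : x \in component -> y \in component ->
  exists k (f : nat -> T), [/\ f 0 = x, f k = y,
    forall i, i <= k -> f i \in component & forall i, i < k -> r (f i) (f i.+1)].
Proof.
move=> xC yC; have /connectP[p + yE] := component_connect xC yC.
move/(pathP x) => pP; exists (size p), (nth x (x :: p)).
have stepP i : i < size p -> r (nth x (x :: p) i) (nth x (x :: p) i.+1).
  by move=> /pP/and3P[].
split=> //; first by rewrite yE (last_nth x).
elim=> // i IH ip; have /and3P[_ W1 r1] := pP i ip.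
by apply: component_closed (IH (ltnW ip)) W1 r1.
Qed.

End Component.

(** * Consequences of hole-freeness *)

Section Walks.
Variables (G : sgraph) (K : {set G}) (x y : G).

Definition walk k (f : nat -> G) := [/\ forall i, i <= k -> f i \in K,
  forall i, i < k -> f i -- f i.+1, x -- f 0 & f k -- y].

(** Adjacency of [x] and [y] is left open: closing the path by the edge [x -- y], or by a further
    vertex adjacent to both ends, produces a cycle. *)
Definition induced_walk k (f : nat -> G) := [/\ forall i, i <= k -> f i \in K,
  forall i j, i < j <= k -> f i -- f j = (j == i.+1),
  forall i, i <= k -> x -- f i = (i == 0) &
  forall i, i <= k -> f i -- y = (i == k)].

(** Strong induction on the length: a late neighbour of [x], an early neighbour of [y] or a chord
    each give a strictly shorter walk. *)
Lemma walk_shorten k f : walk k f -> exists l g, induced_walk l g.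
Proof.
elim/ltn_ind: k f => k IH f [fK fe xf fy].
have [/existsP[[i /= ik] /andP[i0 xi]]|nox] :=
    boolP [exists i : 'I_k.+1, (0 < i) && x -- f i].
  apply: (IH (k - i) _ (fun t => f (t + i))); first lia.
  split=> // [j jk|j jk|]; first by apply: fK; lia.
    by rewrite addSn; apply: fe; lia.
  by rewrite subnK.
have [/existsP[[i /= ik] /andP[i0 yi]]|noy] :=
    boolP [exists i : 'I_k.+1, (i < k) && f i -- y].
  apply: (IH i _ f); first lia.
  by split=> // j jk; [apply: fK|apply: fe]; lia.
have [/existsP[[i /= ik] /existsP[[j /= jk] /andP[ij eij]]]|noe] :=
    boolP [exists i : 'I_k.+1, exists j : 'I_k.+1, (i.+1 < j) && f i -- f j].
  (* [g] takes the chord from [f i] to [f j], skipping the [j - i.+1] vertices between them. *)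
  pose g t := if t <= i then f t else f (t + (j - i.+1)).
  apply: (IH (k - (j - i.+1)) _ g); first lia.
  rewrite /g; split=> // [t tk|t tk|].
  - by case: ifP => ti; apply: fK; lia.
  - have [ti|ti] := ltnP t i; first by rewrite ltnW //; apply: fe; lia.
    have [->|ti'] := eqVneq t i.
      by rewrite leqnn (_ : i.+1 + _ = j) //; lia.
    by rewrite leqNgt ltn_neqAle eq_sym ti' ti /= addSn; apply: fe; lia.
  - rewrite ifN; last lia.
    by rewrite (_ : _ + _ = k) //; lia.
exists k, f; split=> // [i j /andP[ij jk]|i ik|i ik].
- apply/idP/eqP => [eij|->]; last by apply: fe; lia.
  apply/eqP; rewrite eqn_leq ij andbT; apply: contraNT noe; rewrite -ltnNge => ij'.
  have ik : i < k.+1 by lia.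
  apply/existsP; exists (Ordinal ik); apply/existsP; exists (Ordinal (jk : j < k.+1)).
  by rewrite /= ij'.
- apply/idP/eqP => [xi|-> //]; apply/eqP; rewrite -leqn0; apply: contraNT nox.
  by rewrite -ltnNge => i0; apply/existsP; exists (Ordinal (ik : i < k.+1)); rewrite /= i0.
- apply/idP/eqP => [yi|-> //]; apply/eqP; rewrite eqn_leq ik; apply: contraNT noy.
  by rewrite -ltnNge => i0; apply/existsP; exists (Ordinal (ik : i < k.+1)); rewrite /= i0.
Qed.

End Walks.

(** Injectivity need not be assumed: from length 5 on, distinct vertices of a cycle have distinct
    neighbourhoods. In a 4-cycle opposite vertices are twins. *)
Lemma cycle_emb (G : sgraph) n (c : nat -> G) : 5 <= n ->
    (forall i j, i < j < n ->
       c i -- c j = (j == i.+1) || ((i == 0) && (j == n.-1))) ->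
  emb (cycle_graph n) G.
Proof.
move=> n5 cE.
have cS i j : i < n -> j < n -> c i -- c j =
    [|| j == i.+1, i == j.+1, (i == 0) && (j == n.-1) | (j == 0) && (i == n.-1)].
  move=> iln jn; have [ij|ji|<-] := ltngtP i j.
  - rewrite cE; lia.
  - rewrite edge_sym cE; lia.
  - rewrite edge_irrefl; lia.
have cI i j : i < j < n -> c i <> c j.
  move=> /andP[ij jn] cij.
  have nE t : t < n -> c t -- c i = c t -- c j by rewrite cij.
  have : c i.+1 -- c j by rewrite -nE ?cS; lia.
  rewrite cS; try lia; move=> jE; have [i0|i0] := eqVneq i 0.
    have : c n.-1 -- c j by rewrite -nE ?cS; lia.
    rewrite cS; lia.
  have : c i.-1 -- c j by rewrite -nE ?cS; lia.
  rewrite cS; lia.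
exists (fun i : 'I_n => c i) => [i j cij|i j].
  apply: val_inj; have [ij|ji|//] := ltngtP (i : nat) (j : nat).
    by case: (@cI i j); rewrite ?ij ?ltn_ord.
  by case: (@cI j i); rewrite ?ji ?ltn_ord.
rewrite cS // [in RHS]/edge /= /simple_rel /= -val_eqE /=.
have modE a : a < n -> a.+1 %% n = if a == n.-1 then 0 else a.+1.
  move=> an; case: eqP => [->|na]; last by rewrite modn_small; lia.
  by rewrite prednK ?modnn; lia.
rewrite !modE //; have := ltn_ord i; have := ltn_ord j.
by have [?|?] := eqVneq (i : nat) n.-1; have [?|?] := eqVneq (j : nat) n.-1; lia.
Qed.

Section HoleFree.
Variables (G : sgraph) (K : {set G}).
Hypothesis hole_free : forall n, 5 <= n -> ~ emb (cycle_graph n) G.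

(** After shortening, the walk together with [x], [y] and [z] is an induced cycle of length [k + 4],
    so [k = 0] and its only vertex is the common neighbour. *)
Lemma hole_common_nbr (x y z : G) k f : walk K x y k f ->
    ~~ x -- y -> z -- x -> z -- y -> (forall w, w \in K -> ~~ z -- w) ->
  exists p, [/\ p \in K, x -- p & p -- y].
Proof.
move=> /walk_shorten[{}k [{}f [fK fE xE yE]]] xy zx zy zK.
have [k0|k1] := posnP k.
  by subst k; exists (f 0); rewrite fK ?xE ?yE.
case: (@hole_free k.+4) => //.
pose c i := if i == 0 then x else if i <= k.+1 then f i.-1
            else if i == k.+2 then y else z.
apply: (@cycle_emb _ _ c) => // i j /andP[ij jn]; rewrite /c.
have zf t : t <= k -> f t -- z = false.
  by move=> tk; rewrite edge_sym; apply/negbTE/zK/fK.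
have [i0|i0] := eqVneq i 0; have [j0|j0] := eqVneq j 0; try lia.
  have [jk|jk] := leqP j k.+1; first by rewrite xE; lia.
  have [jk2|jk2] := eqVneq j k.+2; first by rewrite (negPf xy); lia.
  by rewrite edge_sym zx; lia.
have [jk|jk] := leqP j k.+1.
  rewrite (leq_trans (ltnW ij) jk) fE; lia.
have [ik|ik] := leqP i k.+1; last first.
  have -> : i == k.+2 by lia.
  have /negPf-> : j != k.+2 by lia.
  by rewrite edge_sym zy; lia.
by have [jk2|jk2] := eqVneq j k.+2; rewrite ?yE ?zf; lia.
Qed.

(** Here the edge [x -- y] closes the shortened walk to an induced cycle of length [k + 3], which
    leaves a triangle or a square. *)
Lemma hole_square (x y : G) k f : walk K x y k f -> x -- y ->
  (exists p, [/\ p \in K, x -- p & p -- y]) \/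
  (exists p q, [/\ p \in K, q \in K & [/\ x -- p, p -- q, q -- y,
                   ~~ x -- q & ~~ p -- y]]).
Proof.
move=> /walk_shorten[{}k [{}f [fK fE xE yE]]] xy.
have [k0|k1] := posnP k.
  by subst k; left; exists (f 0); rewrite fK ?xE ?yE.
have [k1'|k2] := eqVneq k 1.
  by subst k; right; exists (f 0), (f 1); rewrite !fK ?xE ?yE ?fE.
case: (@hole_free k.+3); first lia.
pose c i := if i == 0 then x else if i <= k.+1 then f i.-1 else y.
apply: (@cycle_emb _ _ c) => // [|i j /andP[ij jn]]; rewrite ?/c; first lia.
have [i0|i0] := eqVneq i 0; have [j0|j0] := eqVneq j 0; try lia.
  have [jk|jk] := leqP j k.+1; first by rewrite xE; lia.
  by rewrite xy; lia.
have [jk|jk] := leqP j k.+1.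
  rewrite (leq_trans (ltnW ij) jk) fE; lia.
by rewrite ifT ?yE; lia.
Qed.

End HoleFree.

(** * Recognising the small obstructions *)

(** Distinctness of [f i] and [f j] is automatic when rows [i] and [j] of the table differ; it has
    to be supplied only for non-adjacent twins. *)
Lemma emb_table (G : sgraph) n (r : rel 'I_n) (t : rel nat) (f : nat -> G) :
    (forall i j : 'I_n, simple_rel r i j = t i j) ->
    (forall i j, i < j < n -> f i -- f j = t i j) ->
    (forall i j, i < j < n -> has (fun k => t i k != t j k) (iota 0 n) \/ f i <> f j) ->
  emb (graph_of_rel r) G.
Proof.
move=> rt ft fI.
have fM (i j : 'I_n) : f i -- f j = t i j.
  have [ij|ji|/val_inj<-] := ltngtP i j; first by rewrite ft ?ij ?ltn_ord.
    by rewrite edge_sym -rt simple_rel_sym rt ft ?ji ?ltn_ord.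
  by rewrite edge_irrefl -rt simple_rel_irrefl.
have fN (i j : 'I_n) : i < j -> f i <> f j.
  move=> ij; case: (fI i j) => [|/hasP[k]|//]; first by rewrite ij ltn_ord.
  rewrite mem_iota /= add0n => kn /eqP + fij; apply.
  by rewrite -!(fM _ (Ordinal kn)) fij.
exists (fun i : 'I_n => f i) => [i j fij|i j]; last by rewrite fM -rt.
apply: val_inj; have [/fN[]|/fN[]|//] := ltngtP (i : nat) (j : nat); by rewrite fij.
Qed.

Definition edge_table (s : seq (nat * nat)) : rel nat := fun i j =>
  (i != j) && (((i.+1, j.+1) \in s) || ((j.+1, i.+1) \in s)).

Definition path_compl_table : rel nat := fun i j =>
  [&& i != j, j != i.+1 & i != j.+1].

Lemma path_compl_tableE n (i j : compl (path_graph n)) :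
  i -- j = path_compl_table (val i) (val j).
Proof.
rewrite /edge /= /simple_rel /= /path_compl_table -!val_eqE /=; lia.
Qed.

Ltac table_case :=
  repeat match goal with
  | H : is_true (~~ _) |- _ => move/negbTE in H
  end;
  case=> [|[|[|[|[|[|?]]]]]] [|[|[|[|[|[|?]]]]]] /andP[] // _ //= _;
  (assumption || (rewrite edge_sym; assumption) || (by left) || (by right)).

Lemma hexagon_emb (G : sgraph) (s : seq (nat * nat)) (f : nat -> G) :
    let t := edge_table ([:: (1, 2); (2, 3); (3, 4); (4, 5); (5, 6); (6, 1)] ++ s) in
    (forall i j, i < j < 6 -> f i -- f j = t i j) ->
    (forall i j, i < j < 6 -> has (fun k => t i k != t j k) (iota 0 6) \/ f i <> f j) ->
  emb (hexagon_with s) G.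
Proof.
by move=> t; apply: emb_table => i j; rewrite /simple_rel /= /t /edge_table -val_eqE.
Qed.

Section Patterns.
Variable G : sgraph.
Implicit Types a b c d g h r v : G.

Lemma house_emb r a b c d : r -- a -> r -- b -> a -- b -> a -- d -> b -- c ->
  c -- d -> ~~ r -- c -> ~~ r -- d -> ~~ a -- c -> ~~ b -- d -> emb P5_compl G.
Proof.
move=> ra rb ab ad bc cd rc rd ac bd.
(* The list follows the complementary path: its consecutive pairs are exactly the non-edges of the
   house with roof [r]. *)
apply: (@emb_table _ 5 _ path_compl_table (nth a [:: a; c; r; d; b])).
- exact: path_compl_tableE.
- table_case.
- table_case.
Qed.

Lemma domino_emb a b c d g h :
  a -- b -> b -- c -> c -- d -> d -- g -> g -- h -> h -- a -> b -- g ->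
  ~~ a -- c -> ~~ a -- d -> ~~ a -- g -> ~~ b -- d -> ~~ b -- h -> ~~ c -- g ->
  ~~ c -- h -> ~~ d -- h -> emb domino G.
Proof.
move=> *; apply: (@hexagon_emb _ _ (nth a [:: a; b; c; d; g; h])); table_case.
Qed.

Lemma strip_emb a b c d g h :
  a -- b -> b -- c -> c -- d -> d -- g -> g -- h -> h -- a -> b -- h -> b -- g ->
  c -- g -> ~~ a -- c -> ~~ a -- d -> ~~ a -- g -> ~~ b -- d -> ~~ c -- h ->
  ~~ d -- h -> emb H4 G.
Proof.
move=> *; apply: (@hexagon_emb _ _ (nth a [:: a; b; c; d; g; h])); table_case.
Qed.

Lemma sun_emb a b c d g h :
  a -- b -> b -- c -> c -- d -> d -- g -> g -- h -> h -- a -> b -- d -> b -- h ->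
  d -- h -> ~~ a -- c -> ~~ a -- d -> ~~ a -- g -> ~~ b -- g -> ~~ c -- g ->
  ~~ c -- h -> emb H5 G.
Proof.
move=> *; apply: (@hexagon_emb _ _ (nth a [:: a; b; c; d; g; h])); table_case.
Qed.

(** The pairs {b, h} and {c, g} are completely joined, [a] sees the first pair and [d] the second.
    The adjacencies inside the pairs decide between the three graphs; a non-adjacent pair consists
    of twins, whence the two inequalities. *)
Lemma two_squares_emb a b c d g h :
  b <> h -> c <> g ->
  a -- b -> b -- c -> c -- d -> d -- g -> g -- h -> h -- a -> b -- g -> c -- h ->
  ~~ a -- c -> ~~ a -- d -> ~~ a -- g -> ~~ b -- d -> ~~ d -- h ->
  [\/ emb H1 G, emb H2 G | emb H3 G].
Proof.
move=> bh cg *; case: (boolP (b -- h)) => bh'; case: (boolP (c -- g)) => cg'.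
- by constructor 1; apply: (@hexagon_emb _ _ (nth a [:: a; b; c; d; g; h])); table_case.
- have hb : h -- b by rewrite edge_sym.
  by constructor 2; apply: (@hexagon_emb _ _ (nth a [:: d; c; b; a; h; g])); table_case.
- by constructor 2; apply: (@hexagon_emb _ _ (nth a [:: a; b; c; d; g; h])); table_case.
- by constructor 3; apply: (@hexagon_emb _ _ (nth a [:: a; b; c; d; g; h])); table_case.
Qed.

End Patterns.

(** * Obstruction-free graphs decompose *)

Definition obstruction_free (G : sgraph) : Prop :=
  (forall n : nat, 5 <= n -> ~ emb (cycle_graph n) G) /\
  ~ emb P5_compl G /\ ~ emb domino G /\ ~ emb H1 G /\ ~ emb H2 G /\
  ~ emb H3 G /\ ~ emb H4 G /\ ~ emb H5 G.

(** * Maximal join sets and their co-components *)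

Section JoinSets.
Variable G : sgraph.
Implicit Types (x y z v a b n m : G) (J A : {set G}).

Definition joinset J := [exists A : {set G}, [&& A != set0, A \proper J &
  [forall a in A, forall b in J :\: A, a -- b]]].

Lemma joinsetP J : reflect (exists A a b, [/\ A \subset J, a \in A,
    b \in J, b \notin A & forall x y, x \in A -> y \in J -> y \notin A -> x -- y])
  (joinset J).
Proof.
apply: (iffP existsP) => [[A /and3P[/set0Pn[a aA] /properP[AJ [b bJ bA]] AE]]|].
  exists A, a, b; split=> // x y xA yJ yA; have /forall_inP/(_ x xA) := AE.
  by move=> /forall_inP; apply; rewrite inE yA.
move=> [A [a [b [AJ aA bJ bA AE]]]]; exists A; apply/and3P; split.
- by apply/set0Pn; exists a.
- by apply/properP; split=> //; exists b.
- apply/forall_inP => x xA; apply/forall_inP => y /setDP[yJ yA]; exact: AE.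
Qed.

Definition nonedge : rel G := fun x y => ~~ x -- y.

Lemma nonedge_sym : symmetric nonedge.
Proof. by move=> x y; rewrite /nonedge edge_sym. Qed.

Definition cocomp J x := component nonedge J x.

Section MaxJoinSet.
Variable J : {set G}.
Hypothesis maxJ : maxset joinset J.

Lemma cocomp_self x : x \in cocomp J x. Proof. exact: component_self. Qed.

Lemma cocomp_sub x y : x \in J -> y \in cocomp J x -> y \in J.
Proof. by move=> xJ; apply: component_sub. Qed.

Lemma cocomp_adj x y z :
  x \in J -> y \in cocomp J x -> z \in J -> z \notin cocomp J x -> y -- z.
Proof.
by move=> xJ yx zJ; apply: contraNT => yz; apply: component_closed yx zJ yz.
Qed.

Lemma cocomp_cut x (X : {set G}) a b :
  x \in J -> a \in cocomp J x -> b \in cocomp J x -> a \in X -> b \notin X ->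
  exists s t, [/\ s \in cocomp J x, t \in cocomp J x, s \in X, t \notin X & ~~ s -- t].
Proof. by move=> xJ ax bx; apply: component_cut => //; apply: nonedge_sym. Qed.

Lemma cocomp_trans x y z :
  z \in cocomp J x -> z \in cocomp J y -> y \in cocomp J x.
Proof.
rewrite !inE => xz yz; apply: connect_trans xz _.
by rewrite (sym_connect_sym (restr_sym J nonedge_sym)).
Qed.

(** Were the co-component all of [J], a non-edge would cross the partition that makes [J] a join. *)
Lemma cocomp_proper x : x \in J -> exists2 z, z \in J & z \notin cocomp J x.
Proof.
move=> xJ; case: (pickP [pred z | (z \in J) && (z \notin cocomp J x)]) => [z|noz].
  by case/andP; exists z.
have Jx z : z \in J -> z \in cocomp J x.
  by move=> zJ; have := noz z; rewrite /= zJ => /negbFE.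
have /joinsetP[A [a [b [AJ aA bJ bA AE]]]] := maxsetp maxJ.
have [s [t [_ tx sA tA]]] := cocomp_cut xJ (Jx _ (subsetP AJ _ aA)) (Jx _ bJ) aA bA.
by rewrite AE // (cocomp_sub xJ tx).
Qed.

(** If [v] were adjacent to the whole co-component, that co-component would be complete to the rest
    of [v |: J], a larger join set. *)
Lemma max_nonnbr v x : v \notin J -> x \in J ->
  exists2 y, y \in cocomp J x & ~~ v -- y.
Proof.
move=> vJ xJ; case: (pickP [pred y | (y \in cocomp J x) && ~~ v -- y]) => [y|noy].
  by case/andP; exists y.
have vx y : y \in cocomp J x -> v -- y.
  by move=> yx; have := noy y; rewrite /= yx => /negbFE.
suff /(maxsetsup maxJ)/(_ (subsetUr _ _)) JE : joinset (v |: J).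
  by rewrite -JE setU11 in vJ.
have [z zJ zx] := cocomp_proper xJ.
apply/joinsetP; exists (cocomp J x), x, z; split=> //.
- by apply/subsetP => y /(cocomp_sub xJ) yJ; rewrite inE yJ orbT.
- exact: cocomp_self.
- by rewrite inE zJ orbT.
- move=> s t sx /setU1P[->|tJ] tx; first by rewrite edge_sym vx.
  exact: cocomp_adj tx.
Qed.

Lemma mixed_pair v x : v \notin J -> x \in J -> v -- x -> exists a b,
  [/\ a \in cocomp J x, b \in cocomp J x, v -- a, ~~ v -- b & ~~ a -- b].
Proof.
move=> vJ xJ vx; have [y yx vy] := max_nonnbr vJ xJ.
have [||s [t [sx tx]]] := @cocomp_cut x [set w | v -- w] _ _ xJ (cocomp_self x) yx.
- by rewrite inE.
- by rewrite inE.
by rewrite !inE => vs vt st; exists s, t.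
Qed.

Hypothesis house_free : ~ emb P5_compl G.

(** Mixed pairs in two different co-components form a square with one edge in the neighbourhood of
    [v]: a house with roof [v]. *)
Lemma nbrs_one_cocomp v x y : v \notin J -> x \in J -> y \in J ->
  v -- x -> v -- y -> y \in cocomp J x.
Proof.
move=> vJ xJ yJ vx vy; apply/negPn/negP => yx.
have [a1 [a2 [a1x a2x va1 va2 a12]]] := mixed_pair vJ xJ vx.
have [b1 [b2 [b1y b2y vb1 vb2 b12]]] := mixed_pair vJ yJ vy.
have adj a b : a \in cocomp J x -> b \in cocomp J y -> a -- b.
  move=> ax bY; apply: cocomp_adj ax _ _ => //; first exact: cocomp_sub bY.
  by apply: contra yx => bx; apply: cocomp_trans bx bY.
case: house_free; apply: (@house_emb G v a1 b1 a2 b2) => //; try exact: adj.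
by rewrite edge_sym adj.
Qed.

End MaxJoinSet.
End JoinSets.

Ltac ed := solve [assumption | rewrite edge_sym; assumption].

(** * An outside vertex with two neighbours in a maximal join set *)

Section TwoNeighbours.
Variables (G : sgraph) (J : {set G}) (v n1 n2 : G).
Hypothesis free : obstruction_free G.
Hypothesis nocut : nocutg G.
Hypothesis maxJ : maxset (@joinset G) J.
Hypotheses (vJ : v \notin J) (n1J : n1 \in J) (n2J : n2 \in J).
Hypotheses (vn1 : v -- n1) (vn2 : v -- n2) (n12 : n1 != n2).

Let house_free : ~ emb P5_compl G. Proof. by case: free => _ []. Qed.

Let square_free (a b c d g h : G) : b <> h -> c <> g ->
  a -- b -> b -- c -> c -- d -> d -- g -> g -- h -> h -- a -> b -- g -> c -- h ->
  ~~ a -- c -> ~~ a -- d -> ~~ a -- g -> ~~ b -- d -> ~~ d -- h -> False.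
Proof.
move=> *; have [] : [\/ emb H1 G, emb H2 G | emb H3 G]; last 1 first.
- by case: free => _ [_ [_ [_ [_ []]]]].
- exact: (@two_squares_emb G a b c d g h).
- by case: free => _ [_ [_ []]].
- by case: free => _ [_ [_ [_ []]]].
Qed.

Let A := cocomp J n1.
Let N := [set n in J | v -- n].

Let AJ x : x \in A -> x \in J. Proof. exact: cocomp_sub. Qed.

Let NA n : n \in N -> n \in A.
Proof. by rewrite inE => /andP[nJ vn]; apply: nbrs_one_cocomp vn. Qed.

Let Nv n : n \in N -> v -- n. Proof. by rewrite inE => /andP[]. Qed.

Let NvN x : x \in J -> x \notin N -> ~~ v -- x.
Proof. by move=> xJ; rewrite inE xJ. Qed.

Let n1N : n1 \in N. Proof. by rewrite inE n1J. Qed.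
Let n2N : n2 \in N. Proof. by rewrite inE n2J. Qed.

Let other_nbr n : exists2 n', n' \in N & n' <> n.
Proof.
have [->|/eqP nn] := eqVneq n n1; last by exists n1 => // e; case: nn.
by exists n2 => // e; move: n12; rewrite e eqxx.
Qed.

Variable b : G.
Hypotheses (bJ : b \in J) (bA : b \notin A).

Let Ab x : x \in A -> x -- b. Proof. by move=> xA; apply: cocomp_adj xA _ _. Qed.

Let vb : ~~ v -- b. Proof. by apply: NvN => //; apply: contra bA; apply: NA. Qed.

(** If [n] and [n'] were non-adjacent, [m] would be the roof of a house over the square
    [b n' v n]. *)
Let nbr_split m n n' : m \in A -> m \notin N -> n \in N -> n' \in N ->
  m -- n' -> ~~ m -- n -> n -- n'.
Proof.
move=> mA mN nN n'N mn' mn; apply/negPn/negP => nn'; apply: house_free.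
have vm := NvN (AJ mA) mN; have vn := Nv nN; have vn' := Nv n'N.
have mb := Ab mA; have nb := Ab (NA nN); have n'b := Ab (NA n'N).
by apply: (@house_emb G m b n' v n); ed.
Qed.

(* Among the vertices of [A :\: N], one with the most non-neighbours in [N] works:
   the house and the 3-sun [H5] exclude any neighbour of it in [N]. *)
Let anticomplete_vertex :
  exists m, [/\ m \in A, m \notin N & forall n, n \in N -> ~~ m -- n].
Proof.
have [m1 m1A vm1] := max_nonnbr maxJ vJ n1J.
have m1N : m1 \notin N by rewrite inE (negPf vm1) andbF.
pose D m := [set n in N | ~~ m -- n].
have [m /andP[mA mN] mmax] : exists2 m, (m \in A) && (m \notin N) &
    forall m', (m' \in A) && (m' \notin N) -> #|D m'| <= #|D m|.
  have P1 : (m1 \in A) && (m1 \notin N) by rewrite m1N andbT.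
  by have [m mP mm] := @arg_maxnP _ m1 (fun m => (m \in A) && (m \notin N)) (fun m => #|D m|) P1;
    exists m.
exists m; split=> // e0 e0N; apply/negP => me0.
have [||e [y [eA yA]]] := @cocomp_cut _ _ n1 [set n in N | m -- n] e0 m n1J (NA e0N) mA.
- by rewrite inE e0N.
- by rewrite inE (negPf mN).
rewrite inE => /andP[eN me]; rewrite inE => yE ey.
have [yN|yN] := boolP (y \in N).
  rewrite yN /= in yE; have := nbr_split mA mN yN eN me yE.
  by rewrite edge_sym (negPf ey).
have Dy := mmax y; rewrite yA yN /= in Dy.
have eD : e \notin D m by rewrite inE eN me.
have eDy : e \in D y by rewrite inE eN edge_sym.
(* Otherwise [D m] would be a proper subset of [D y], as [e] lies only in the latter, against the
   choice of [m]. *)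
have /subsetPn[d] : ~~ (D m \subset D y).
  apply/negP => sub; have := Dy isT; rewrite leqNgt => /negP; apply.
  by apply: proper_card; apply/properP; split=> //; exists e.
rewrite inE => /andP[dN md]; rewrite inE dN negbK => yd.
have de := nbr_split mA mN dN eN me md.
have vm := NvN (AJ mA) mN; have vy := NvN (AJ yA) yN.
have vd := Nv dN; have ve := Nv eN.
have mb := Ab mA; have yb := Ab yA; have db := Ab (NA dN); have eb := Ab (NA eN).
have [my|my] := boolP (m -- y).
  by apply: house_free; apply: (@house_emb G v d e m y); ed.
case: free => _ [_ [_ [_ [_ [_ [_ []]]]]]].
by apply: (@sun_emb G v d y b m e); ed.
Qed.

Lemma two_nbrs_contradiction : False.
Proof.
have [m [mA mN mNN]] := anticomplete_vertex.
have vm := NvN (AJ mA) mN.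
(* A second vertex [b'] of [J] outside [A] would make {n1, n2} and {b, b'} completely joined pairs,
   with [v] attached to the first and [m] to the second. *)
have bU b' : b' \in J -> b' \notin A -> b' = b.
  move=> b'J b'A; apply/eqP/negPn/negP => /eqP b'b.
  have Ab' x : x \in A -> x -- b' by move=> xA; apply: cocomp_adj xA _ _.
  have vb' : ~~ v -- b' by apply: NvN => //; apply: contra b'A; apply: NA.
  have mb := Ab mA; have mb' := Ab' _ mA.
  have n1b := Ab (NA n1N); have n1b' := Ab' _ (NA n1N).
  have n2b := Ab (NA n2N); have n2b' := Ab' _ (NA n2N).
  have mn1 := mNN _ n1N; have mn2 := mNN _ n2N.
  apply: (@square_free v n1 b m b' n2); try ed; last by move=> e; apply: b'b.
  by apply/eqP.
(* The co-component of [b] is now a singleton, so by [max_nonnbr] no vertex outside [J] is adjacent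
   to [b]. *)
have bnbr w : w -- b -> w \in A.
  move=> wb; have [wJ|wJ] := boolP (w \in J).
    by apply: contraLR wb => /(bU w wJ) ->; rewrite edge_irrefl.
  have [y yb wy] := max_nonnbr maxJ wJ bJ.
  have yE : y = b.
    apply: bU; first exact: cocomp_sub yb.
    by apply: contra bA => yA; apply: cocomp_trans yA yb.
  by rewrite yE wb in wy.
(* With [K] the component of [m] in [W], every edge leaving [K] ends at a vertex that has a
   neighbour in [N]. *)
pose W := [set w | (w \notin N) && [forall n in N, ~~ n -- w]].
have WN w n : w \in W -> n \in N -> ~~ n -- w.
  by rewrite inE => /andP[_ /forall_inP]; apply.
have mW : m \in W.
  by rewrite inE mN; apply/forall_inP => n nN; rewrite edge_sym mNN.
pose K := component (@edge G) W m.
have KW k : k \in K -> k \in W by apply: component_sub.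
have KN k : k \in K -> k \notin N by move/KW; rewrite inE => /andP[].
have notK n w : n \in N -> n -- w -> w \notin K.
  by move=> nN nw; apply/negP => /KW/WN/(_ nN); rewrite nw.
have bK : b \notin K by apply: notK n1N (Ab (NA n1N)).
have vK : v \notin K by apply: notK n1N _; rewrite edge_sym.
(* As [b] is not a cut vertex, some edge leaves [K] at a vertex [q] other than [b]. A walk through
   [K] then links [q] to [m], hence to [b]. *)
have [|k [q [kK qK qb kq]]] := nocut bK (component_self _ _ m : m \in K) vK.
  by apply: contraNneq vJ => ->.
have qW : q \notin W.
  by apply: contra qK => qW; apply: component_closed kK qW kq.
have qN : q \notin N.
  by apply: contraL kq => qN; rewrite edge_sym; apply: WN qN; apply: KW.
have [n nN nq] : exists2 n, n \in N & n -- q.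
  move: qW; rewrite inE qN /= => /forall_inPn[n nN]; rewrite negbK => nq.
  by exists n.
have mb := Ab mA; have nb := Ab (NA nN); have vn := Nv nN.
have [l [f [f0 fl fK fe]]] := component_walk (@edge_sym G) mW kK (component_self _ _ m).
have fW : walk K q b l f by split=> //; rewrite ?f0 ?fl // edge_sym.
have hole_free : forall n : nat, 5 <= n -> ~ emb (cycle_graph n) G by case: free.
have [n' n'N n'n] := other_nbr n.
have n'b := Ab (NA n'N); have vn' := Nv n'N.
(* If [q -- b], a square through [K] gives a house with roof [n]; a common neighbour [p] in [K]
   gives two squares or [H4], according to whether [q -- n']. *)
have [qb'|qb'] := boolP (q -- b).
  have qA := bnbr _ qb'; have vq := NvN (AJ qA) qN.
  have [[p [pK qp pb]]|[s [t [sK tK [qs st tb qt sb]]]]] := hole_square hole_free fW qb'; last first.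
    have ns := WN _ _ (KW _ sK) nN; have nt := WN _ _ (KW _ tK) nN.
    by apply: house_free; apply: (@house_emb G n q b t s); ed.
  have vp := NvN (AJ (bnbr _ pb)) (KN _ pK).
  have np := WN _ _ (KW _ pK) nN; have n'p := WN _ _ (KW _ pK) n'N.
  have [qn'|qn'] := boolP (q -- n').
    apply: (@square_free v n b p q n'); try ed; first by move=> e; apply: n'n.
    by move=> e; rewrite e eqxx in qb.
  have n'n_ : n' -- n by apply: (nbr_split qA) => //; rewrite edge_sym.
  have [_ [_ [_ [_ [_ [_ [noH4 _]]]]]]] := free.
  by apply: noH4; apply: (@strip_emb G p b n' v n q); ed.
(* If [q] and [b] are non-adjacent, [n] is a common neighbour that misses [K], so hole-freeness
   provides [p] in [K]. *)
have nK w : w \in K -> ~~ n -- w by move=> /KW/WN; apply.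
have [p [pK qp pb]] := hole_common_nbr hole_free fW qb' nq nb nK.
have vp := NvN (AJ (bnbr _ pb)) (KN _ pK).
have np := nK _ pK; have n'p := WN _ _ (KW _ pK) n'N.
have vq : ~~ v -- q.
  apply/negP => vq; apply: house_free; apply: (@house_emb G v n q p b); ed.
have [n'q|n'q] := boolP (n' -- q).
  apply: (@square_free v n b p q n'); try ed; first by move=> e; apply: n'n.
  by move=> e; rewrite e eqxx in qb.
have [nn'|nn'] := boolP (n -- n').
  by apply: house_free; apply: (@house_emb G n' n b p q); ed.
have [_ [_ [nodomino _]]] := free.
by apply: nodomino; apply: (@domino_emb G v n q p b n'); ed.
Qed.

End TwoNeighbours.

(** * Prime obstruction-free graphs have no edge *)

Section Prime.
Variable G : sgraph.
Hypothesis free : obstruction_free G.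
Hypothesis primeG : primeg G.

Let coconG : coconnectedg G. Proof. by case: primeG. Qed.
Let nocut : nocutg G. Proof. by case: primeG. Qed.
Let house_free : ~ emb P5_compl G. Proof. by case: free => _ []. Qed.
Let hole_free n : 5 <= n -> ~ emb (cycle_graph n) G.
Proof. by case: free => h _; apply: h. Qed.

Lemma max_joinset_nbr (J : {set G}) v x y : maxset (@joinset G) J ->
  v \notin J -> x \in J -> y \in J -> v -- x -> v -- y -> x = y.
Proof.
move=> maxJ vJ xJ yJ vx vy; apply/eqP/negPn/negP => xy.
have [b bJ bx] := cocomp_proper maxJ xJ.
exact: (two_nbrs_contradiction free nocut maxJ vJ xJ yJ vx vy xy bJ bx).
Qed.

Lemma joinset_proper (J : {set G}) : joinset J -> exists v, v \notin J.
Proof.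
move/joinsetP=> [A [a [b [AJ aA bJ bA AE]]]].
have [s [t [sA tA st]]] := coconG aA bA.
exists t; apply: contra st => tJ; exact: AE.
Qed.

Section MaxJoinSet.
Variable J : {set G}.
Hypothesis maxJ : maxset (@joinset G) J.

(** Two adjacent vertices of [J] attached to one outside component are joined by a walk through it;
    by [hole_square] it yields a triangle or a square, and a triangle would give an outside vertex
    two neighbours in [J]. *)
Lemma square_on_max_joinset : exists x y u w,
  [/\ x \in J, y \in J, u \notin J, w \notin J &
      [/\ x -- y, x -- u, u -- w, w -- y & ~~ x -- w /\ ~~ u -- y]].
Proof.
have one := max_joinset_nbr maxJ.
have [v0 v0J] := joinset_proper (maxsetp maxJ).
have v0C : v0 \in ~: J by rewrite inE.
pose K := component (@edge G) (~: J) v0.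
have KJ k : k \in K -> k \notin J by move/(component_sub v0C); rewrite inE.
pose att x := [exists k in K, k -- x].
have walkK x y : att x -> att y -> exists l f, walk K x y l f.
  case/exists_inP=> k kK kx /exists_inP[k' k'K ky].
  have [l [f [f0 fl fK fe]]] := component_walk (@edge_sym G) v0C kK k'K.
  by exists l, f; split; rewrite ?f0 ?fl // edge_sym.
(* Since [x] is not a cut vertex, [K] is attached to [J] elsewhere too. *)
have attach x : x \in J -> exists2 y, y \in J & (y != x) && att y.
  move=> xJ; have [z zJ zx] := cocomp_proper maxJ xJ.
  have JK y : y \in J -> y \notin K by apply: contraL => /KJ.
  have zx' : z != x by apply: contraNneq zx => ->; apply: cocomp_self.
  have [k [y [kK yK yx ky]]] := nocut (JK x xJ) (component_self _ _ v0 : v0 \in K) (JK z zJ) zx'.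
  exists y; last by rewrite yx; apply/exists_inP; exists k.
  by apply: contraNT yK => yJ; apply: component_closed kK _ ky; rewrite ?inE.
have [x [y [xJ yJ xA yA xy]]] : exists x y, [/\ x \in J, y \in J, att x, att y & x -- y].
  have /joinsetP[_ [_ [x0 [_ _ x0J _ _]]]] := maxsetp maxJ.
  have [x xJ /andP[_ xA]] := attach x0 x0J.
  have [y yJ /andP[yx yA]] := attach x xJ.
  have [xy|xy] := boolP (x -- y); first by exists x, y.
  have yx' : y \in cocomp J x.
    by apply: component_closed (component_self _ _ _) yJ xy.
  (* Two non-adjacent attachments share a co-component, so [z] from another one is adjacent to both.
     Either [z] is attached as well, or [hole_common_nbr] gives an outside vertex adjacent to both
     [x] and [y]. *)
  have [z zJ zx] := cocomp_proper maxJ xJ.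
  have xz : x -- z by apply: cocomp_adj zx => //; apply: cocomp_self.
  have yz : y -- z by apply: cocomp_adj zx.
  have [zA|zA] := boolP (att z); first by exists x, z.
  have zK k : k \in K -> ~~ z -- k.
    by move=> kK; apply: contra zA => zk; apply/exists_inP; exists k; rewrite // edge_sym.
  have [l [f fW]] := walkK x y xA yA.
  have [||p [pK xp py]] := hole_common_nbr hole_free fW xy _ _ zK; rewrite 1?edge_sym //.
  case/eqP: yx; apply: (one p) => //; first exact: KJ.
  by rewrite edge_sym.
have [l [f fW]] := walkK x y xA yA.
case: (hole_square hole_free fW xy) => [[p [pK xp py]]|].
  have px : p -- x by rewrite edge_sym.
  by have := one p x y (KJ _ pK) xJ yJ px py => e; rewrite e edge_irrefl in xy.
move=> [u [w [uK wK [xu uw wy xw uy]]]]; exists x, y, u, w.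
by split=> //; apply: KJ.
Qed.

(** One of [x] and [y] dominates. Otherwise a non-neighbour [z1] of [y] and a non-neighbour [z2] of
    [x] are adjacent, and together with the square they form a domino. *)
Lemma dominating_vertex x y u w :
  x \in J -> y \in J -> u \notin J -> w \notin J ->
  x -- y -> x -- u -> u -- w -> w -- y -> ~~ x -- w -> ~~ u -- y ->
  exists2 d, d \in J & forall z, z \in J -> z != d -> d -- z.
Proof.
move=> xJ yJ uJ wJ xy xu uw wy xw uy.
have one := max_joinset_nbr maxJ.
have uJN z : z \in J -> z != x -> ~~ u -- z.
  move=> zJ; apply: contra => uz; apply/eqP; apply: (one u) => //.
  by rewrite edge_sym.
have wJN z : z \in J -> z != y -> ~~ w -- z.
  by move=> zJ; apply: contra => wz; apply/eqP; apply: (one w).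
(* A common neighbour in [J] would be the roof of a house over the square [x y w u]. *)
have nz z : z \in J -> z -- x -> ~~ z -- y.
  move=> zJ zx; apply/negP => zy; apply: house_free.
  have uz : ~~ u -- z.
    by apply: uJN => //; apply: contraTneq zx => ->; rewrite edge_irrefl.
  have wz : ~~ w -- z.
    by apply: wJN => //; apply: contraTneq zy => ->; rewrite edge_irrefl.
  by apply: (@house_emb G z x y w u); ed.
have yx : y \notin cocomp J x.
  apply/negP => yx; have [z zJ zx] := cocomp_proper maxJ xJ.
  have xz : x -- z by apply: cocomp_adj zx => //; apply: cocomp_self.
  have yz : y -- z by apply: cocomp_adj zx.
  have zx' : z -- x by rewrite edge_sym.
  by have := nz z zJ zx'; rewrite edge_sym yz.
have inx z : z \in J -> ~~ z -- x -> z -- y.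
  move=> zJ zx; apply: (cocomp_adj xJ) => //.
  by apply: component_closed (component_self _ _ _) zJ _; rewrite // /nonedge edge_sym.
have [/existsP[z1 /and3P[z1J z1y z1N]]|noy] :=
    boolP [exists z, [&& z \in J, z != y & ~~ z -- y]]; last first.
  exists y => // z zJ zy; apply: contraNT noy => yz.
  by apply/existsP; exists z; rewrite zJ zy edge_sym.
have [/existsP[z2 /and3P[z2J z2x z2N]]|nox] :=
    boolP [exists z, [&& z \in J, z != x & ~~ z -- x]]; last first.
  exists x => // z zJ zx; apply: contraNT nox => xz.
  by apply/existsP; exists z; rewrite zJ zx edge_sym.
have z1x : z1 -- x by apply: contraNT z1N; apply: inx.
have z2y := inx z2 z2J z2N.
have z2C : z2 \in cocomp J x.
  by apply: component_closed (component_self _ _ _) z2J _; rewrite // /nonedge edge_sym.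
have z12 : z2 -- z1.
  apply: (cocomp_adj xJ z2C z1J); apply: contra z1N => z1C.
  by apply: (cocomp_adj xJ).
have u1 : ~~ u -- z1.
  by apply: uJN => //; apply: contraTneq z1x => ->; rewrite edge_irrefl.
have w1 := wJN z1 z1J z1y; have u2 := uJN z2 z2J z2x.
have w2 : ~~ w -- z2.
  by apply: wJN => //; apply: contraTneq z2y => ->; rewrite edge_irrefl.
have [_ [_ [nodomino _]]] := free; case: nodomino.
by apply: (@domino_emb G u x z1 z2 y w); ed.
Qed.

End MaxJoinSet.

Lemma prime_free_edgeless (x y : G) : ~~ x -- y.
Proof.
apply/negP => xy.
have joinE : joinset [set x; y].
  apply/joinsetP; exists [set x], x, y; split; rewrite ?inE ?eqxx ?orbT //.
  - by rewrite subsetUl.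
  - by apply: contraTneq xy => ->; rewrite edge_irrefl.
  - by move=> s t /set1P-> /set2P[->|->]; rewrite ?inE ?eqxx.
have [J maxJ _] := maxset_exists joinE.
have [{xy joinE}x [{}y [u [w [xJ yJ uJ wJ [xy xu uw wy [xw uy]]]]]]] := square_on_max_joinset maxJ.
(* From here [x] and [y] belong to the square, which is the join of its two non-adjacent pairs {x,
   w} and {u, y}. *)
have joinS : joinset [set x; w; u; y].
  apply/joinsetP; exists [set x; w], x, u; split; rewrite ?inE ?eqxx ?orbT //.
  - by apply/subsetP => z; rewrite !inE => /orP[]->; rewrite ?orbT.
  - apply/norP; split; [apply: contraTneq xu|apply: contraTneq uw] => ->;
      by rewrite edge_irrefl.
  - move=> s t /set2P sE; rewrite !inE => + tN; rewrite (negPf tN) /=.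
    by case: sE => -> /orP[]/eqP->; ed.
have [J2 maxJ2 /subsetP sub2] := maxset_exists joinS.
have [] : exists2 d, d \in J2 & forall z, z \in J2 -> z != d -> d -- z.
  have [x2 [y2 [u2 [w2 [? ? ? ? [? ? ? ? [? ?]]]]]]] := square_on_max_joinset maxJ2.
  exact: (dominating_vertex maxJ2 (x := x2) (y := y2) (u := u2) (w := w2)).
move=> d dJ2 dE.
have x2 : x \in J2 by apply: sub2; rewrite !inE eqxx.
have y2 : y \in J2 by apply: sub2; rewrite !inE eqxx ?orbT.
have u2 : u \in J2 by apply: sub2; rewrite !inE eqxx ?orbT.
have w2 : w \in J2 by apply: sub2; rewrite !inE eqxx ?orbT.
have inout s t : s \in J -> t \notin J -> s != t.
  by move=> sJ; apply: contraNneq => <-.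
(* A vertex of the square has a non-neighbour in [J2], namely the opposite one, so it cannot be
   [d]. *)
have xd : x != d.
  by apply: contraNneq xw => xd; rewrite xd; apply: dE; rewrite // -xd eq_sym inout.
have yd : y != d.
  by apply: contraNneq uy => yd; rewrite yd edge_sym; apply: dE; rewrite // -yd eq_sym inout.
have ud : u != d.
  by apply: contraNneq uy => ud; rewrite ud; apply: dE; rewrite // -ud inout.
have dx := dE x x2 xd; have dy := dE y y2 yd; have du := dE u u2 ud.
(* Inside [J], [d] would be a second neighbour of [u] besides [x]; outside, [d] itself would have
   the two neighbours [x] and [y]. *)
have [dJ|dJ] := boolP (d \in J).
  case/eqP: xd; apply: (max_joinset_nbr maxJ uJ) => //; by rewrite edge_sym.
have xyE := max_joinset_nbr maxJ dJ xJ yJ dx dy.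
by rewrite xyE edge_irrefl in xy.
Qed.

End Prime.

(** * Primality of the obstructions *)

Lemma connect_steps (T : finType) (r : rel T) (c : nat -> T) i j : symmetric r ->
    (forall t, minn i j <= t < maxn i j -> r (c t) (c t.+1)) ->
  connect r (c i) (c j).
Proof.
move=> r_sym; wlog ij : i j / i <= j => [IH cE|].
  have [ij|/ltnW ji] := leqP i j; first exact: IH.
  by rewrite (sym_connect_sym r_sym); apply: IH => // t; rewrite minnC maxnC; apply: cE.
rewrite (minn_idPl ij) (maxn_idPr ij); elim: j ij => [|j IH].
  by rewrite leqn0 => /eqP->; rewrite connect0.
rewrite leq_eqVlt => /predU1P[->|ij] cE; first exact: connect0.
apply: connect_trans (IH ij _) (connect1 (cE j _)); last by apply/andP.
by move=> t /andP[it tj]; apply: cE; rewrite it ltnW.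
Qed.

(** [c] runs around a Hamiltonian cycle, and any [n] consecutive values exhaust [G]. Deleting [c k]
    leaves the path from [c (k + 1)] to [c (k + n - 1)], so there is no cut vertex. *)
Lemma hamiltonian_prime (G : sgraph) n (c : nat -> G) : 0 < n -> #|G| = n ->
    (forall i, c i -- c i.+1) ->
    (forall k i j, i < n -> j < n -> c (k + i) = c (k + j) -> i = j) ->
    (forall a b, connect (@nonedge G) a b) ->
  primeg G.
Proof.
move=> n0 Gn cE cI coc.
have cS k x : exists2 i, i < n & x = c (k + i).
  pose f (i : 'I_n) := c (k + i).
  have fI : injective f by move=> i j /cI ij; apply/val_inj/ij.
  have [|g _ gK] := inj_card_bij fI; first by rewrite Gn card_ord.
  by exists (g x) => //; rewrite -[LHS]gK.
split=> [A a b|A a b|v A a b vA aA bA bv].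
- apply: connect_cross; have [i _ ->] := cS 0 a; have [j _ ->] := cS 0 b.
  by apply: connect_steps => //; apply: edge_sym.
- exact: connect_cross.
have [k _ vE] := cS 0 v; rewrite add0n in vE.
have cv t : 0 < t < n -> c (k + t) \in [set~ v].
  move=> /andP[t0 tn]; rewrite !inE vE; apply/eqP; rewrite -{2}[k]addn0 => /cI.
  by move=> /(_ tn n0) t00; rewrite t00 in t0.
have steps x : x != v -> exists2 i, 0 < i < n & x = c (k + i).
  move=> xv; have [[|i] iln xE] := cS k x; last by exists i.+1.
  by rewrite xE addn0 vE eqxx in xv.
have [|i /andP[i0 iln] aE] := steps a; first by apply: contraNneq vA => <-.
have [j /andP[j0 jn] bE] := steps b bv.
have ab : connect (restr (@edge G) [set~ v]) a b.
  rewrite aE bE.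
  apply: (@connect_steps _ _ (fun t => c (k + t))) => [|t tij].
    exact/restr_sym/edge_sym.
  apply/and3P; split; [apply: cv; lia|apply: cv; lia|].
  by rewrite addnS.
have [x [y [xA yA /and3P[_ yv xy]]]] := connect_cross ab aA bA.
by exists x, y; rewrite !inE in yv.
Qed.

Lemma walk_connect (T : finType) (r : rel T) (s : seq T) :
  symmetric r -> sorted r s -> (forall x, x \in s) -> forall a b, connect r a b.
Proof.
case: s => [|x p] r_sym /= xp sT a b; first by have := sT a.
have xC y : connect r x y by apply: path_connect xp _ (sT y).
by apply: connect_trans (xC b); rewrite (sym_connect_sym r_sym).
Qed.

Definition rot_ord n (n0 : 0 < n) i : 'I_n := Ordinal (ltn_pmod i n0).

Lemma rot_ord_inj n (n0 : 0 < n) k i j :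
  i < n -> j < n -> rot_ord n0 (k + i) = rot_ord n0 (k + j) -> i = j.
Proof.
move=> iln jn /(congr1 val) /= /eqP; rewrite eqn_modDl => /eqP.
by rewrite !modn_small.
Qed.

Lemma cycle_prime n : 5 <= n -> primeg (cycle_graph n).
Proof.
move=> n5; have n0 : 0 < n by lia.
pose c : nat -> cycle_graph n := rot_ord n0.
have cI k i j : i < n -> j < n -> c (k + i) = c (k + j) -> i = j.
  exact: rot_ord_inj.
have cE i : c i -- c i.+1.
  rewrite /edge /= /simple_rel /=; apply/andP; split.
    apply/eqP => cc; have /(_ (ltnW (ltnW (ltnW n5)))) := @cI i 0 1 n0.
    by rewrite addn0 addn1 => /(_ cc).
  by rewrite -[(i %% n).+1]addn1 modnDml addn1 eqxx.
have cN i d : 1 < d -> d.+1 < n -> nonedge (c i) (c (i + d)).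
  move=> d1 dn; rewrite /nonedge /edge /= /simple_rel /= negb_and negb_or; apply/orP; right.
  rewrite -[(i %% n).+1]addn1 -[((i + d) %% n).+1]addn1 !modnDml -addnA.
  rewrite eqn_modDl -{1}[i]addn0 eqn_modDl !modn_small; lia.
apply: (hamiltonian_prime n0 _ cE cI); first by rewrite card_ord.
have sym := @nonedge_sym (cycle_graph n).
have co i : connect (@nonedge _) (c i) (c i.+1).
  (* [c (i + 3)] is at offsets 3 and 2 from [c i] and [c i.+1], hence non-adjacent to both when
     [n >= 5]. *)
  apply: (@connect_trans _ _ (c (i + 3))); first by apply/connect1/cN; lia.
  rewrite sym_connect_sym //; apply: connect1.
  by rewrite -[i + 3](@addSnnS i 2); apply: cN; lia.
have co0 (a : 'I_n) : connect (@nonedge _) (c 0) a.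
  have -> : a = c a by apply: val_inj; rewrite /= modn_small.
  by elim: (a : nat) => [|i IH]; rewrite ?connect0 //; apply: connect_trans IH (co i).
by move=> a b; apply: connect_trans (co0 b); rewrite sym_connect_sym.
Qed.

(** The hexagon is the Hamiltonian cycle; [w] is a walk in the complement through all vertices and
    certifies co-connectedness. *)
Lemma hexagon_prime s (w : seq 'I_6) :
  sorted (@nonedge (hexagon_with s)) w -> (forall x, x \in w) ->
  primeg (hexagon_with s).
Proof.
move=> w_sorted wT; have n0 : 0 < 6 by [].
apply: (@hamiltonian_prime (hexagon_with s) 6 (rot_ord n0)) => //.
- by rewrite card_ord.
- move=> i; rewrite /edge /= /simple_rel /= -val_eqE /=.
  have := ltn_pmod i n0; rewrite -(addn1 i) -modnDml.
  by case: (i %% 6) => [|[|[|[|[|[|?]]]]]].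
- exact: rot_ord_inj.
- by apply: walk_connect w_sorted wT; apply: nonedge_sym.
Qed.

Local Notation v5 i := (@Ordinal 5 i isT) (only parsing).
Local Notation v6 i := (@Ordinal 6 i isT) (only parsing).

Lemma P5_compl_prime : primeg P5_compl.
Proof.
have n0 : 0 < 5 by [].
(* Steps of 2 modulo 5 never join consecutive vertices of the path, which gives the Hamiltonian
   cycle 0, 2, 4, 1, 3. *)
apply: (@hamiltonian_prime P5_compl 5 (fun i => rot_ord n0 (i * 2))) => //.
- by rewrite card_ord.
- move=> i; rewrite path_compl_tableE /= mulSn addnC -modnDml.
  have := ltn_pmod (i * 2) n0.
  by case: ((i * 2) %% 5) => [|[|[|[|[|?]]]]].
- by move=> k i j i5 j5 /(congr1 val) /=; lia.
- apply: (@walk_connect P5_compl _ [:: v5 0; v5 1; v5 2; v5 3; v5 4]) => //.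
    exact: nonedge_sym.
  by case=> [[|[|[|[|[|?]]]]] ?].
Qed.

Ltac six := by case=> [[|[|[|[|[|[|?]]]]]] ?].

Lemma domino_prime : primeg domino.
Proof. by apply: (@hexagon_prime _ [:: v6 1; v6 3; v6 0; v6 4; v6 2; v6 5]); last six. Qed.
Lemma H1_prime : primeg H1.
Proof. by apply: (@hexagon_prime _ [:: v6 2; v6 0; v6 4; v6 0; v6 3; v6 1; v6 3; v6 5]); last six. Qed.
Lemma H2_prime : primeg H2.
Proof. by apply: (@hexagon_prime _ [:: v6 2; v6 0; v6 4; v6 0; v6 3; v6 1; v6 5]); last six. Qed.
Lemma H3_prime : primeg H3.
Proof. by apply: (@hexagon_prime _ [:: v6 5; v6 1; v6 3; v6 0; v6 4; v6 2]); last six. Qed.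
Lemma H4_prime : primeg H4.
Proof. by apply: (@hexagon_prime _ [:: v6 1; v6 3; v6 5; v6 2; v6 0; v6 4]); last six. Qed.
Lemma H5_prime : primeg H5.
Proof. by apply: (@hexagon_prime _ [:: v6 3; v6 0; v6 4; v6 1; v6 4; v6 2; v6 5]); last six. Qed.

(** * Decomposition into sums and joins *)

(** Used with [U] the whole graph for connectedness and co-connectedness, and with [U] the
    complement of a vertex for cut vertices. *)
Lemma cut_or_cross (T : finType) (r : rel T) (U : {set T}) :
  (exists (A : {set T}) a b, [/\ A \subset U, a \in A, b \in U, b \notin A &
     forall x y, x \in A -> y \in U -> y \notin A -> ~~ r x y]) \/
  (forall (A : {set T}) a b, A \subset U -> a \in A -> b \in U -> b \notin A ->
     exists x y, [/\ x \in A, y \in U, y \notin A & r x y]).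
Proof.
pose crossb (A : {set T}) := [exists x in A, exists y in U :\: A, r x y].
case: (pickP [pred A : {set T} | [&& A \subset U, A != set0, U :\: A != set0 &
    ~~ crossb A]]) => [A /and4P[AU /set0Pn[a aA] /set0Pn[b /setDP[bU bA]] noc]|noA].
  left; exists A, a, b; split=> // x y xA yU yA; apply: contra noc => xy.
  by apply/exists_inP; exists x => //; apply/exists_inP; exists y; rewrite ?inE ?yA.
right=> A a b AU aA bU bA; have := noA A; rewrite /= AU /=.
have -> : A != set0 by apply/set0Pn; exists a.
have -> /= : U :\: A != set0 by apply/set0Pn; exists b; rewrite inE bA.
move=> /negbFE/exists_inP[x xA /exists_inP[y /setDP[yU yA] xy]].
by exists x, y.
Qed.

Section Pieces.
Variables (G : sgraph) (A : {set G}).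

Lemma card_induced : #|induced A| = #|A|.
Proof. by rewrite card_sig; apply: eq_card => x. Qed.

Lemma val_compl (y : induced (~: A)) : val y \notin A.
Proof. by have : val y \in ~: A := valP y; rewrite inE. Qed.

Definition unsum (z : induced A + induced (~: A)) : G :=
  match z with inl x => val x | inr y => val y end.

Lemma unsum_bij : bijective unsum.
Proof.
apply: inj_surj_bij => [[x|x] [y|y] /= xy|z].
- by congr inl; apply: val_inj.
- by have := val_compl y; rewrite -[val y]xy (valP x).
- by have := val_compl x; rewrite [val x]xy (valP y).
- by congr inr; apply: val_inj.
have [zA|zA] := boolP (z \in A); first by exists (inl (exist _ z zA)).
have zC : z \in ~: A by rewrite inE.
by exists (inr (exist _ z zC)).
Qed.

Lemma sum0_giso : (forall x y, x \in A -> y \notin A -> ~~ x -- y) ->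
  giso (sum0 (induced A) (induced (~: A))) G.
Proof.
move=> noA; exists unsum; first exact: unsum_bij.
have noAC (x : induced A) (y : induced (~: A)) : val x -- val y = false.
  exact/negbTE/noA/val_compl/(valP x).
by move=> [x|x] [y|y] //=; rewrite ?noAC // edge_sym noAC.
Qed.

Lemma join_giso : (forall x y, x \in A -> y \notin A -> x -- y) ->
  giso (join (induced A) (induced (~: A))) G.
Proof.
move=> noA; exists unsum; first exact: unsum_bij.
have noAC (x : induced A) (y : induced (~: A)) : val x -- val y.
  exact/noA/val_compl/(valP x).
by move=> [x|x] [y|y] //=; rewrite ?noAC // edge_sym noAC.
Qed.

Variable v : G.
Hypothesis vA : v \notin A.

Let vA' : v \in v |: A. Proof. exact: setU11. Qed.
Let vC : v \in ~: A. Proof. by rewrite inE. Qed.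
Let u1 : induced (v |: A) := exist _ v vA'.
Let u2 : induced (~: A) := exist _ v vC.

(** Both pieces contain a copy of [v], as [~: A] keeps it and [v |: A] adds it; these are the copies
    that get identified. *)
Lemma sum1_giso : (forall x y, x \in A -> y \notin A -> y != v -> ~~ x -- y) ->
  giso (sum1 u1 u2) G.
Proof.
move=> noA.
pose f (z : sum1 u1 u2) : G := match val z with inl x => val x | inr y => val y end.
have fl a : f (sum1_inl u1 u2 a) = val a by [].
have fr b : f (sum1_inr u1 u2 b) = val b.
  by rewrite /f val_sum1_inr; case: eqP => [->|].
have u12 : sum1_inl u1 u2 u1 = sum1_inr u1 u2 u2.
  by apply: val_inj; rewrite val_sum1_inr eqxx.
have inA a : a != u1 -> val a \in A.
  move=> av; have /setU1P[aE|//] := valP a.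
  by case/eqP: av; apply: val_inj.
have fM_lr a b : b != u2 ->
    f (sum1_inl u1 u2 a) -- f (sum1_inr u1 u2 b) = sum1_inl u1 u2 a -- sum1_inr u1 u2 b.
  move=> bv; have [->|av] := eqVneq a u1; first by rewrite u12 !fr sum1_inr_mono.
  rewrite (negPf (sum1_cross av bv)) fl fr; apply/negbTE/noA; first exact: inA.
    exact: val_compl.
  by apply: contraNneq bv => bE; apply/eqP/val_inj.
exists f; last first.
  move=> x y; case: (sum1_inlr x) => [[a ->]|[a av ->]];
    case: (sum1_inlr y) => [[b ->]|[b bv ->]].
  - by rewrite !fl sum1_inl_mono.
  - exact: fM_lr.
  - by rewrite edge_sym fM_lr // edge_sym.
  - by rewrite !fr sum1_inr_mono.
have lr_neq (a : induced (v |: A)) (b : induced (~: A)) : b != u2 -> val a = val b -> False.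
  move=> bv ab; have := val_compl b; rewrite -ab => aA.
  have /setU1P[aE|] := valP a; last by rewrite (negPf aA).
  by case/eqP: bv; apply: val_inj; rewrite /= -aE ab.
apply: inj_surj_bij => [x y|z].
  case: (sum1_inlr x) => [[a ->]|[a av ->]]; case: (sum1_inlr y) => [[b ->]|[b bv ->]].
  - by rewrite !fl => /val_inj->.
  - by rewrite fl fr => /lr_neq[].
  - by rewrite fl fr => /esym/lr_neq[].
  - by rewrite !fr => /val_inj->.
have [zA|zA] := boolP (z \in v |: A).
  by exists (sum1_inl u1 u2 (exist _ z zA)).
have zC : z \in ~: A by apply: contraNT zA; rewrite !inE negbK => ->; rewrite orbT.
by exists (sum1_inr u1 u2 (exist _ z zC)); rewrite fr.
Qed.

End Pieces.

Lemma free_induced (G : sgraph) (S : {set G}) :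
  obstruction_free G -> obstruction_free (induced S).
Proof.
have sub H : ~ emb H G -> ~ emb H (induced S).
  by move=> noH /emb_trans/(_ (emb_induced S)).
by move=> [h [? [? [? [? [? [? ?]]]]]]]; do ![split]; try exact: sub; move=> n /h; apply: sub.
Qed.

Lemma single_vertex_giso (G : sgraph) : #|G| = 1 -> giso K1 G.
Proof.
move=> G1; have /card_gt0P[x _] : 0 < #|G| by rewrite G1.
have Gx y : y = x by apply/(fintype_le1P _) => //; rewrite G1.
exists (fun _ => x); last by move=> i j; rewrite edge_irrefl /edge /= /simple_rel /= andbF.
by apply: inj_surj_bij => [i j _|y]; [rewrite !ord1|exists ord0].
Qed.

(** Strong induction on the order: a disconnected, co-disconnected or separable graph splits into
    smaller non-empty pieces, and what remains is [K1] or an impossible prime graph. Non-emptiness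
    is required because no operation yields the empty graph. *)
Lemma free_sesquicograph (G : sgraph) :
  0 < #|G| -> obstruction_free G -> sesquicograph G.
Proof.
have [n] := ubnP #|G|; elim: n G => // n IH G Gn G0 free.
have rec (S : {set G}) x y : x \in S -> y \notin S -> sesquicograph (induced S).
  move=> xS yS; apply: IH; rewrite ?card_induced.
  - rewrite -ltnS; apply: leq_trans Gn; rewrite ltnS; apply: proper_card.
    by apply/properP; split; [exact: subset_predT|exists y].
  - by apply/card_gt0P; exists x.
  - exact: free_induced.
have [[A [a [b [_ aA _ bA noA]]]]|con] := cut_or_cross (@edge G) setT.
  apply: Sesqui_giso (@sum0_giso G A _) _ => [x y xA yA|]; first exact: noA.
  by apply: Sesqui_sum0; [apply: (rec _ a b)|apply: (rec _ b a)]; rewrite ?inE ?aA.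
have [[A [a [b [_ aA _ bA noA]]]]|cocon] := cut_or_cross (@nonedge G) setT.
  apply: Sesqui_giso (@join_giso G A _) _ => [x y xA yA|].
    by apply/negPn; apply: noA.
  by apply: Sesqui_join; [apply: (rec _ a b)|apply: (rec _ b a)]; rewrite ?inE ?aA.
have [G1|G2] := leqP #|G| 1.
  apply: Sesqui_giso Sesqui_K1; apply: single_vertex_giso.
  by apply/eqP; rewrite eqn_leq G1.
have [/existsP[v /existsP[A /and4P[vA A0 A1 noA]]]|nocut] := boolP [exists v, exists A : {set G},
  [&& v \notin A, A != set0, ~: (v |: A) != set0 &
   [forall x in A, forall y in ~: (v |: A), ~~ x -- y]]].
  have [a aA] := set0Pn _ A0; have [b] := set0Pn _ A1.
  rewrite !inE negb_or => /andP[bv bA].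
  apply: Sesqui_giso (@sum1_giso G A v vA _) _ => [x y xA yA yv|].
    by have /forall_inP/(_ x xA)/forall_inP := noA; apply; rewrite !inE negb_or yv.
  apply: Sesqui_sum1; [apply: (rec _ a b)|apply: (rec _ b a)]; by rewrite !inE ?aA ?orbT ?negb_or ?bv.
have primeG : primeg G.
  split=> [A a b aA bA|A a b aA bA|v A a b vA aA bA bv].
  - by have [x [y []]] := con A a b (subsetT _) aA (in_setT _) bA; exists x, y.
  - by have [x [y []]] := cocon A a b (subsetT _) aA (in_setT _) bA; exists x, y.
  have [[A' [a' [b' [sub a'A]]]]|] := cut_or_cross (@edge G) [set~ v].
    rewrite !inE => b'v b'A noA; case/negP: nocut.
    apply/existsP; exists v; apply/existsP; exists A'; apply/and4P; split.
    - by apply/negP => /(subsetP sub); rewrite !inE eqxx.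
    - by apply/set0Pn; exists a'.
    - by apply/set0Pn; exists b'; rewrite !inE negb_or b'v.
    - apply/forall_inP => x xA; apply/forall_inP => y; rewrite !inE negb_or.
      by case/andP=> yv yA; apply: noA; rewrite ?inE.
  move=> /(_ A a b)[]; rewrite ?inE //.
    by apply/subsetP => x xA; rewrite !inE; apply: contraNneq vA => <-.
  by move=> x [y [xA]]; rewrite !inE => yv yA xy; exists x, y.
(* A connected graph on two or more vertices has an edge, against [prime_free_edgeless]. *)
have /card_gt1P[x [y [_ _ xy]]] := G2.
have [|s [t [_ _ _ st]]] := con _ x y (subsetT _) (set11 x) (in_setT y).
  by rewrite inE eq_sym.
by have := prime_free_edgeless free primeG s t; rewrite st.
Qed.

(** * The characterization by forbidden induced subgraphs *)

Theorem theorem1p2 (G : sgraph) (G_nonempty : 0 < #|G|) :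
  sesquicograph G <->
  (forall n : nat, 5 <= n -> ~ has_induced G (cycle_graph n)) /\
  ~ has_induced G P5_compl /\
  ~ has_induced G domino /\
  ~ has_induced G H1 /\
  ~ has_induced G H2 /\
  ~ has_induced G H3 /\
  ~ has_induced G H4 /\
  ~ has_induced G H5.
Proof.
split=> [sG|[nC [nP [nD [n1 [n2 [n3 [n4 n5]]]]]]]].
  have no P : primeg P -> 1 < #|P| -> ~ has_induced G P.
    by move=> pP P2 /has_inducedP; apply: sesquicograph_prime_free.
  split=> [n n5|]; first by apply: no; [apply: cycle_prime|rewrite card_ord; lia].
  do ![split]; apply: no; rewrite ?card_ord //.
  - exact: P5_compl_prime.
  - exact: domino_prime.
  - exact: H1_prime.
  - exact: H2_prime.
  - exact: H3_prime.
  - exact: H4_prime.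
  - exact: H5_prime.
apply: free_sesquicograph => //.
by do ![split]; try (by move=> /has_inducedP); move=> n /nC nCn /has_inducedP.
Qed.
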